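(* Let $$M_{1}=\begin{pmatrix}7&-6&6\\8&-7&7\\4&-4&3\end{pmatrix},\quad M_{2}=\begin{pmatrix}7&6&-6\\8&7&-7\\4&3&-4\end{pmatrix},\quad M_{3}=\begin{pmatrix}7&6&0\\8&7&0\\4&3&1\end{pmatrix},$$ $$M_{4}=\begin{pmatrix}7&0&6\\8&0&7\\4&1&3\end{pmatrix},\quad M_{5}=\begin{pmatrix}7&0&-6\\8&0&-7\\4&1&-4\end{pmatrix}.$$ An integer triangle is primitive Eisensteinian if and only if its side lengths (listed in the order fixed in the context) are $(1,1,1)$, or they are of the form $(a,b,c)$ or $(a,b,b-c)$, where $$\begin{pmatrix} a \\ b \\ c \end{pmatrix}=M_{i_1}M_{i_2}\cdots M_{i_k}\,v,\qquad v\in\left\{\begin{pmatrix}7\\8\\5\end{pmatrix},\begin{pmatrix}13\\15\\7\end{pmatrix}\right\},$$ for some integer $k\ge 0$ and indices $i_1,\dots,i_k\in\{1,2,3,4,5\}$ (for $k=0$ the product is the identity matrix). Moreover, every primitive Eisensteinian triangle is obtained exactly once in this way: it is either $(1,1,1)$ or it arises from exactly one choice of the data consisting of the vector $v$, the finite (possibly empty) sequence $(i_1,\dots,i_k)$, and which of the two forms $(a,b,c)$ or $(a,b,b-c)$ is used, and these two alternatives are mutually exclusive.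
   Context: A primitive Eisensteinian triangle is a (non-degenerate) triangle with positive integer side lengths $(a,b,c)$ such that the angle opposite the side of length $a$ equals $\pi/3$ and $\gcd(a,b,c)=1$. The side lengths are listed as an ordered triple with the side opposite the angle $\pi/3$ first, and the other two sides ordered so that $b>c$; the only exception is the equilateral triangle $(1,1,1)$, for which $b=c$ and which is also counted as primitive Eisensteinian. *)

(* Defs.v *)
From HB Require Import structures.
From mathcomp Require Import all_boot all_order all_algebra.
From mathcomp Require Import reals trigo.

Set Implicit Arguments.
Unset Strict Implicit.
Unset Printing Implicit Defensive.

Import Order.TTheory GRing.Theory Num.Theory.
Local Open Scope ring_scope.

(* The library norm on 'rV[R]_2 is the sup norm, hence an explicit Euclidean
   norm on the plane. *)
Definition dot2 (R : realType) (u v : 'rV[R]_2) : R :=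
  \sum_(i < 2) u 0 i * v 0 i.

Definition enorm (R : realType) (u : 'rV[R]_2) : R := Num.sqrt (dot2 u u).

Definition edist (R : realType) (P Q : 'rV[R]_2) : R := enorm (Q - P).

(* The angle at the vertex [A] of the triangle [A B C]; it is only used for
   non-degenerate triangles, where the denominator is non-zero. *)
Definition angle_at (R : realType) (A B C : 'rV[R]_2) : R :=
  acos (dot2 (B - A) (C - A) / (enorm (B - A) * enorm (C - A))).

Definition nondegenerate (R : realType) (A B C : 'rV[R]_2) : bool :=
  free [:: B - A; C - A].

Definition eisensteinian (R : realType) (a b c : int) : Prop :=
  [/\ 0 < a, 0 < b, 0 < c &
      exists A B C : 'rV[R]_2,
        [/\ nondegenerate A B C,
            edist B C = a%:~R, edist C A = b%:~R, edist A B = c%:~R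
          & angle_at A B C = pi / 3%:R]].

Definition primitive_eisensteinian (R : realType) (a b c : int) : Prop :=
  [/\ eisensteinian R a b c, gcdz (gcdz a b) c = 1
    & c < b \/ (a, b, c) = (1, 1, 1)].

Definition mx3 (rows : seq (seq int)) : 'M[int]_3 :=
  \matrix_(i < 3, j < 3) nth 0 (nth [::] rows i) j.

Definition cv3 (x y z : int) : 'cV[int]_3 :=
  \col_(i < 3) nth 0 [:: x; y; z] i.

Definition M1 : 'M[int]_3 := mx3 [:: [:: 7; -6;  6]; [:: 8; -7;  7]; [:: 4; -4;  3]].
Definition M2 : 'M[int]_3 := mx3 [:: [:: 7;  6; -6]; [:: 8;  7; -7]; [:: 4;  3; -4]].
Definition M3 : 'M[int]_3 := mx3 [:: [:: 7;  6;  0]; [:: 8;  7;  0]; [:: 4;  3;  1]].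
Definition M4 : 'M[int]_3 := mx3 [:: [:: 7;  0;  6]; [:: 8;  0;  7]; [:: 4;  1;  3]].
Definition M5 : 'M[int]_3 := mx3 [:: [:: 7;  0; -6]; [:: 8;  0; -7]; [:: 4;  1; -4]].

(* The index i : 'I_5 is zero-based: [gen i] is the (i+1)-st matrix. *)
Definition gen (i : 'I_5) : 'M[int]_3 := nth 0 [:: M1; M2; M3; M4; M5] i.

Definition start_vectors : seq 'cV[int]_3 := [:: cv3 7 8 5; cv3 13 15 7].

(* The starting vector, the sequence of indices, and which of the two forms is
   used: [false] for (a, b, c) and [true] for (a, b, b - c). *)
Definition code : Type := ('cV[int]_3 * seq 'I_5 * bool)%type.

Definition yields (d : code) (a b c : int) : Prop :=
  let: (v, s, second_form) := d in
  v \in start_vectors /\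
  let w := (\prod_(i <- s) gen i) *m v in
  (a, b, c) =
    (w 0 0, w 1 0, if second_form then w 1 0 - w 2%:R 0 else w 2%:R 0).

(* Main.v *)
Require Import Defs.
From mathcomp Require Import all_boot all_order all_algebra.
From mathcomp Require Import reals trigo.
From mathcomp Require Import zify ring lra.

Import Order.TTheory GRing.Theory Num.Theory.
Local Open Scope ring_scope.

(** By the law of cosines, an angle of 60 degrees opposite the side a means
    a^2 = b^2 - bc + c^2 ([eisensteinianP]), so the task is to list the primitive
    integer points of this cone with 0 < c < b.

    The quadratic form b^2 - bc + c^2 is the squared length on the hexagonal
    lattice. Its symmetries cut the (b, c)-plane into six sectors of 60 degrees,
    one of which is 0 < c < b; the map (b, c) -> (b, b - c) reflects that sector
    in its own axis. Each generator factors as gen i = M3 o turn i, where the five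
    maps turn i carry the sector 0 < c < b onto five of the six sectors and M3 is
    an automorphism of the cone ([gen_cv3], [marked_M3], [marked_turn]).

    The image under M3 of a cone point lies in 0 < c < b exactly when the point
    avoids the closed sixth sector ([sector_M3]). Hence, for a cone point x with
    0 < c < b, the point M3^-1 x is either inside exactly one of the five sectors,
    which determines i and a parent of x, or on a ray between two sectors. The
    parent has a smaller first coordinate 7a - 6b, so the descent stops
    ([descent]).

    The reflection (a, b, c) -> (a, b, b - c) is accounted for by a congruence:
    being a primitive point of the cone forces exactly one of (b, c) and
    (b, b - c) to be (0, 1), (1, 0) or (3, 3) modulo 4 ([balanced_mirror]), and
    this condition is invariant under all the generators. On the rays between
    sectors the only primitive points with this congruence, outside the closed
    sixth sector, are (1, 0, 1) and (1, 1, 0) ([marked_on_axis]), and M3 sends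
    them to (7, 8, 5) and (13, 15, 7). So every primitive balanced point of the
    sector is reached ([word_onto]), and by a unique word because each step of
    the descent is forced ([word_inj]). *)

(** * Triangles with an angle of 60 degrees *)

(** The triple angle formula makes cos (pi / 3) a root of
    4y^3 - 3y + 1 = (y + 1)(2y - 1)^2, and it is positive. *)
Lemma cos_pi3 (R : realType) : cos (pi / 3%:R) = 2^-1 :> R.
Proof.
set x := pi / 3%:R; set y := cos x.
have p0 : 0 < pi :> R := pi_gt0 R.
have y0 : 0 < y.
  by apply: cos_gt0_pihalf; rewrite /x; apply/andP; split; lra.
have E : (y + 1) * (2 * y - 1) ^+ 2 = 0.
  have : cos (x + x + x) = -1 by rewrite -cospi; congr cos; rewrite /x; field.
  rewrite !cosD !sinD -/y => E3; have := cos2Dsin2 x; rewrite -/y => S.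
  have {}S : sin x * sin x = 1 - y * y by rewrite -S; ring.
  have : 4 * y ^+ 3 - 3 * y + 1 = (y * y - sin x * sin x) * y
      - (sin x * y + y * sin x) * sin x + 1.
    have -> : (y * y - sin x * sin x) * y - (sin x * y + y * sin x) * sin x + 1
      = y * y * y - 3 * (sin x * sin x) * y + 1 by ring.
    by rewrite S; ring.
  rewrite E3 addNr => <-; ring.
move/eqP: E; rewrite mulf_eq0 expf_eq0 /= => /orP[/eqP|/eqP]; lra.
Qed.

Lemma dot2E (R : realType) (u v : 'rV[R]_2) :
  dot2 u v = u 0 0 * v 0 0 + u 0 1 * v 0 1.
Proof.
rewrite /dot2 !big_ord_recl big_ord0 addr0.
by congr (_ + _ * _); congr (_ _ _); apply: val_inj.
Qed.

Lemma dot2_ge0 (R : realType) (u : 'rV[R]_2) : 0 <= dot2 u u.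
Proof. by rewrite dot2E -!expr2 addr_ge0 ?sqr_ge0. Qed.

Lemma sqr_enorm (R : realType) (u : 'rV[R]_2) : enorm u ^+ 2 = dot2 u u.
Proof. by rewrite sqr_sqrtr ?dot2_ge0. Qed.

Lemma enormN (R : realType) (u : 'rV[R]_2) : enorm (- u) = enorm u.
Proof. by rewrite /enorm !dot2E !mxE !mulrNN. Qed.

Lemma cauchy_schwarz2 (R : realType) (u v : 'rV[R]_2) :
  `|dot2 u v| <= enorm u * enorm v.
Proof.
rewrite -ler_sqr ?nnegrE ?mulr_ge0 ?sqrtr_ge0 // real_normK ?num_real //.
(* Lagrange's identity: the defect is the square of the determinant. *)
rewrite exprMn !sqr_enorm !dot2E -subr_ge0.
have := sqr_ge0 (u 0 0 * v 0 1 - u 0 1 * v 0 0); congr (0 <= _); ring.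
Qed.

Lemma law_of_cosines (R : realType) (u v : 'rV[R]_2) :
  enorm (v - u) ^+ 2 = enorm u ^+ 2 + enorm v ^+ 2 - 2 * dot2 u v.
Proof. by rewrite !sqr_enorm !dot2E !mxE; ring. Qed.

Lemma acos_eq_pi3 (R : realType) (x : R) :
  -1 <= x <= 1 -> (acos x = pi / 3%:R <-> x = 2^-1).
Proof.
move=> x1; split=> [E | ->]; first by rewrite -(acosK x1) E cos_pi3.
by rewrite -cos_pi3 cosK // in_itv /=; have := pi_ge0 R; lra.
Qed.

Lemma eisensteinianP (R : realType) (a b c : int) :
  eisensteinian R a b c <->
  [/\ 0 < a, 0 < b, 0 < c & a ^+ 2 = b ^+ 2 - b * c + c ^+ 2].
Proof.
split=> [[a0 b0 c0 [A [B [C [_ Ea Eb Ec]]]]] | [a0 b0 c0 Q]].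
  rewrite /angle_at; move: Ea Eb Ec; rewrite /edist.
  have -> : C - B = (C - A) - (B - A) by rewrite opprB addrA subrK.
  rewrite -[A - C]opprB enormN; set u := B - A; set v := C - A.
  move=> Ea Eb Ec ang; split=> //.
  have n0 : 0 < enorm u * enorm v by rewrite Eb Ec mulr_gt0 ?ltr0z.
  have CS := cauchy_schwarz2 _ u v.
  have /acos_eq_pi3 [+ _] : -1 <= dot2 u v / (enorm u * enorm v) <= 1.
    by rewrite -ler_norml normrM normfV (gtr0_norm n0) ler_pdivrMr // mul1r.
  move=> /(_ ang) E.
  have {}E : dot2 u v = 2^-1 * (enorm u * enorm v).
    by rewrite -E divfK // gt_eqF.
  have := law_of_cosines _ u v; rewrite E Ea Eb Ec => L.
  apply/eqP; rewrite -(eqr_int R) !(rmorphXn, rmorphD, rmorphN, rmorphM) /=.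
  by rewrite L; apply/eqP; field.
split=> //.
have b0' : 0 < b%:~R :> R by rewrite ltr0z.
have c0' : 0 < c%:~R :> R by rewrite ltr0z.
have a0' : 0 < a%:~R :> R by rewrite ltr0z.
(* The triangle with vertices 0, c and b exp(i pi/3) in the complex plane. *)
pose u : 'rV[R]_2 := \row_j [:: c%:~R; 0]`_j.
pose v : 'rV[R]_2 := \row_j [:: b%:~R / 2; b%:~R * Num.sqrt 3 / 2]`_j.
have s3 : Num.sqrt 3 ^+ 2 = 3 :> R by rewrite sqr_sqrtr.
have s0 : 0 < Num.sqrt 3 :> R by rewrite sqrtr_gt0.
have Euv : dot2 u v = 2^-1 * (c%:~R * b%:~R) by rewrite dot2E !mxE /=; field.
have Eu : enorm u = c%:~R.
  by rewrite /enorm dot2E !mxE /= mulr0 addr0 -expr2 sqrtr_sqr gtr0_norm.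
have Ev : enorm v = b%:~R.
  rewrite /enorm dot2E !mxE /= -[RHS]gtr0_norm // -sqrtr_sqr; congr Num.sqrt.
  transitivity (b%:~R ^+ 2 / 4 * (1 + Num.sqrt 3 ^+ 2) : R); first by field.
  by rewrite s3; field.
exists 0, u, v; rewrite /Defs.nondegenerate /edist /angle_at !subr0 sub0r enormN.
split=> //.
- rewrite free_cons span_seq1 seq1_free; apply/andP; split.
    apply/negP => /vlineP[k /rowP E].
    have /eqP := E 1; rewrite !mxE /= eq_sym !mulf_eq0 invr_eq0.
    rewrite (gt_eqF b0') (gt_eqF s0) pnatr_eq0 !orbF => /eqP k0.
    by have := E 0; rewrite !mxE /= k0 mul0r => /eqP; rewrite gt_eqF.
  by apply/eqP => /rowP/(_ 0); rewrite !mxE /= => E; move: b0'; lra.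
- have QR : a%:~R ^+ 2 = b%:~R ^+ 2 - b%:~R * c%:~R + c%:~R ^+ 2 :> R.
    by have := congr1 (intr : int -> R) Q;
      rewrite !(rmorphXn, rmorphD, rmorphN, rmorphM).
  apply/eqP; rewrite -(eqrXn2 (n := 2)) ?sqrtr_ge0 ?(ltW a0') //; apply/eqP.
  by rewrite law_of_cosines Euv Eu Ev QR; field.
rewrite Euv Eu Ev; apply/acos_eq_pi3; rewrite mulfK ?gt_eqF ?mulr_gt0 //.
by lra.
Qed.
(** * Arithmetic of the cone *)

(** Three alternate vertices of the hexagon of shortest vectors of the lattice
    (those of norm 1), taken modulo 4; the reflection (b, c) -> (b, b - c)
    exchanges them with the other three. *)
Definition balanced (b c : int) : bool :=
  ((b %% 4)%Z, (c %% 4)%Z) \in [:: (0, 1); (1, 0); (3, 3)].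

(** The primitive cone points to be enumerated, up to the choice of a sector:
    each mirror pair (a, b, c), (a, b, b - c) contains exactly one of them.
    Primitivity is a Bezout relation because that form is transported by
    unimodular maps. *)
Definition marked (a b c : int) : Prop :=
  [/\ 0 < a, a ^+ 2 = b ^+ 2 - b * c + c ^+ 2,
      exists p q r : int, p * a + q * b + r * c = 1 & balanced b c].

(** The hexagonal symmetry left in a generator once M3 is factored out, the
    identity for M3 itself; it is a symmetry of the hexagon that preserves the
    three alternate vertices (0, 1), (1, 0), (-1, -1). *)
Definition turn (i : 'I_5) (b c : int) : int * int :=
  nth (0, 0)
    [:: (c - b, - b); (b - c, - c); (b, c); (c, b); (- c, b - c)] i.

Lemma ltr_of_sqr (x y : int) : 0 < y -> x ^+ 2 < y ^+ 2 -> x < y.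
Proof. by move=> y0; apply: contraTT; rewrite -!leNgt => yx; nia. Qed.

Lemma balancedE (b c : int) : balanced b c =
  [|| ((b %% 4)%Z == 0) && ((c %% 4)%Z == 1),
      ((b %% 4)%Z == 1) && ((c %% 4)%Z == 0)
    | ((b %% 4)%Z == 3) && ((c %% 4)%Z == 3)].
Proof. by rewrite /balanced !inE !xpair_eqE. Qed.

Lemma balanced_M3 (a b c : int) :
  balanced (8 * a + 7 * b) (4 * a + 3 * b + c) = balanced b c.
Proof. by rewrite !balancedE; apply/idP/idP; lia. Qed.

Lemma balanced_turn (i : 'I_5) (b c : int) :
  balanced (turn i b c).1 (turn i b c).2 = balanced b c.
Proof.
rewrite !balancedE.
by case: i => [[|[|[|[|[|i]]]]] //= _]; rewrite /turn /=; apply/idP/idP; lia.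
Qed.

(** Makes M3 and its inverse preserve the sign of the first coordinate, which
    becomes 7a + 6b or 7a - 6b. *)
Lemma cone_slope (a b c : int) :
  0 < a -> a ^+ 2 = b ^+ 2 - b * c + c ^+ 2 -> `|6 * b| < 7 * a.
Proof.
move=> a0 Q; apply: ltr_of_sqr; first by rewrite pmulr_rgt0.
have pos := exprn_gt0 2 a0; have sq := sqr_ge0 (b - 2 * c).
by rewrite real_normK ?num_real //; lia.
Qed.

Lemma marked_M3 (a b c : int) :
  marked (7 * a + 6 * b) (8 * a + 7 * b) (4 * a + 3 * b + c) <-> marked a b c.
Proof.
rewrite /marked balanced_M3; split=> -[a0 Q [p [q [r E]]] ->].
- have Q' : a ^+ 2 = b ^+ 2 - b * c + c ^+ 2.
    apply/eqP; rewrite -subr_eq0; move/eqP: Q; rewrite -subr_eq0.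
    by congr (_ == 0); ring.
  split=> //; last first.
    exists (7 * p + 8 * q + 4 * r), (6 * p + 7 * q + 3 * r), r.
    by rewrite -[RHS]E; ring.
  by have := cone_slope _ _ _ a0 Q; rewrite ltr_norml; lia.
- have Q' : (7 * a + 6 * b) ^+ 2 = (8 * a + 7 * b) ^+ 2
      - (8 * a + 7 * b) * (4 * a + 3 * b + c) + (4 * a + 3 * b + c) ^+ 2.
    apply/eqP; rewrite -subr_eq0; move/eqP: Q; rewrite -subr_eq0.
    by congr (_ == 0); ring.
  split=> //; last first.
    exists (7 * p - 8 * q - 4 * r), (- 6 * p + 7 * q + 3 * r), r.
    by rewrite -[RHS]E; ring.
  by have := cone_slope _ _ _ a0 Q; rewrite ltr_norml; lia.
Qed.

Lemma marked_turn (i : 'I_5) (a b c : int) :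
  marked a (turn i b c).1 (turn i b c).2 <-> marked a b c.
Proof.
rewrite /marked balanced_turn.
case: i => [[|[|[|[|[|i]]]]] //= _]; rewrite /turn /=;
  split=> -[a0 Q [p [q [r E]]] ->]; (split=> //; first lia); exists p.
- by exists (- q - r), q; rewrite -E; ring.
- by exists r, (- q - r); rewrite -E; ring.
- by exists q, (- q - r); rewrite -E; ring.
- by exists q, (- q - r); rewrite -E; ring.
- by exists r, q; rewrite -E; ring.
- by exists r, q; rewrite -E; ring.
- by exists r, (- q - r); rewrite -E; ring.
- by exists (- q - r), q; rewrite -E; ring.
Qed.

(** Uniqueness of the parent: the five images of the open sector 0 < c < b are
    disjoint. *)
Lemma turn_inj {i j : 'I_5} {b c b' c' : int} :
  0 < c < b -> 0 < c' < b' -> turn i b c = turn j b' c' ->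
  [/\ i = j, b = b' & c = c'].
Proof.
case: i => [[|[|[|[|[|i]]]]] //= ?]; case: j => [[|[|[|[|[|j]]]]] //= ?];
  rewrite /turn /= => s s' [E1 E2]; try lia;
  by split; [apply: val_inj | lia | lia].
Qed.

Lemma turn_off_axes (i : 'I_5) (b c : int) :
  0 < c < b -> ((turn i b c).1 != 0) && ((turn i b c).2 != 0).
Proof. by case: i => [[|[|[|[|[|i]]]]] //= _]; rewrite /turn /=; lia. Qed.

(** Existence of the parent. The five images fill the plane up to the three lines
    that bound the sectors and the sector b <= c <= 0, b < 0. *)
Lemma turn_onto (b c : int) :
  b != 0 -> c != 0 -> b != c -> (b < 0) && (c <= 0) ==> (c < b) ->
  exists i b' c', 0 < c' < b' /\ turn i b' c' = (b, c).
Proof.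
move=> b0 c0 bc; rewrite /turn.
have [bpos|bneg] : (0 < b) \/ (b < 0) by lia.
  have [cneg|cpos] : (c < 0) \/ (0 < c) by lia.
    by exists (inord 1), (b - c), (- c); rewrite inordK //=;
      split; [lia | congr pair; ring].
  have [cb|cb] : (c < b) \/ (b < c) by lia.
    by exists (inord 2), b, c; rewrite inordK //=;
      split; [lia | congr pair; ring].
  by exists (inord 3), c, b; rewrite inordK //=;
      split; [lia | congr pair; ring].
have [cneg|cpos] : (c < 0) \/ (0 < c) by lia.
  move=> H; exists (inord 0), (- c), (b - c); rewrite inordK //=;
      split; [lia | congr pair; ring].
by exists (inord 4), (c - b), (- b); rewrite inordK //=;
      split; [lia | congr pair; ring].
Qed.

(** Squaring turns the two inequalities on the left into inequalities between b
    and c alone, since 16 a^2 - (3b + c)^2 = (7b - 15c)(b - c) and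
    16 a^2 - (c - 4b)^2 = c (15c - 8b) on the cone; at least one of
    them fails exactly on the closed sixth sector. *)
Lemma sector_M3 (a b c : int) : 0 < a -> a ^+ 2 = b ^+ 2 - b * c + c ^+ 2 ->
  (0 < 4 * a + 3 * b + c < 8 * a + 7 * b) = ((b < 0) && (c <= 0) ==> (c < b)).
Proof.
move=> a0 Q.
have below : (0 < 4 * a + 3 * b + c) =
    (0 <= 3 * b + c) || (0 < (7 * b - 15 * c) * (b - c)).
  have [ge0|lt0] /= := leP 0 (3 * b + c); first by apply/idP; lia.
  apply/idP/idP => h.
    have : (- (3 * b + c)) ^+ 2 < (4 * a) ^+ 2 by nia.
    lia.
  suff : - (3 * b + c) < 4 * a by lia.
  by apply: ltr_of_sqr; [lia | lia].
have above : (4 * a + 3 * b + c < 8 * a + 7 * b) =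
    (c <= 4 * b) || (c * (8 * b - 15 * c) < 0).
  have [ge0|lt0] /= := leP c (4 * b); first by apply/idP; lia.
  apply/idP/idP => h.
    have : (c - 4 * b) ^+ 2 < (4 * a) ^+ 2 by nia.
    lia.
  suff : c - 4 * b < 4 * a by lia.
  by apply: ltr_of_sqr; [lia | lia].
rewrite below above.
have [b0|b0] /= := ltP b 0; last first.
  apply/andP; split.
    have [//|lt0] /= := leP 0 (3 * b + c); nia.
  have [//|lt0] /= := leP c (4 * b); nia.
have [c0|c0] /= := leP c 0; last first.
  apply/andP; split.
    have [//|lt0] /= := leP 0 (3 * b + c); nia.
  apply/orP; right; nia.
have [cb|cb] := ltP c b.
  apply/andP; split; apply/orP; right; nia.
apply/negP => /andP[/orP[h1|h1] /orP[h2|h2]]; nia.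
Qed.

Lemma sector_turn (i : 'I_5) (a b c : int) :
  marked a b c -> 0 < c < b ->
  0 < 4 * a + 3 * (turn i b c).1 + (turn i b c).2
    < 8 * a + 7 * (turn i b c).1.
Proof.
move=> m s; have [a0 Q _ _] := (marked_turn i a b c).2 m.
rewrite sector_M3 //.
by move: s; case: i Q => [[|[|[|[|[|i]]]]] //= ?]; rewrite /turn /=; lia.
Qed.

(** * Descent *)

Lemma gen_cv3 (i : 'I_5) (a b c : int) :
  gen i *m cv3 a b c =
  cv3 (7 * a + 6 * (turn i b c).1) (8 * a + 7 * (turn i b c).1)
      (4 * a + 3 * (turn i b c).1 + (turn i b c).2).
Proof.
apply/colP => k; rewrite /gen /turn.
case: i => [[|[|[|[|[|i]]]]] //= _]; case: k => [[|[|[|k]]] //= lt_k];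
  rewrite !mxE !big_ord_recl big_ord0 !mxE /=; ring.
Qed.

Lemma cv3_inj {a b c a' b' c' : int} :
  cv3 a b c = cv3 a' b' c' -> [/\ a = a', b = b' & c = c'].
Proof.
by move=> /colP E; split; [move: (E 0) | move: (E 1) | move: (E 2%:R)];
  rewrite !mxE.
Qed.

(** The starting vectors are the images under M3 of (1, 0, 1) and (1, 1, 0), which
    lie on rays between sectors. *)
Lemma start_cv3 {v : 'cV[int]_3} : v \in start_vectors ->
  exists b c : int, [/\ balanced b c, b == 0 \/ c == 0, marked 1 b c
    & v = cv3 (7 * 1 + 6 * b) (8 * 1 + 7 * b) (4 * 1 + 3 * b + c)].
Proof.
rewrite !inE => /orP[]/eqP->.
  by exists 0, 1; split; [| left | split=> //; exists 1, 0, 0 | congr cv3].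
by exists 1, 0; split; [| right | split=> //; exists 1, 0, 0 | congr cv3].
Qed.

Definition word (s : seq 'I_5) (v : 'cV[int]_3) : 'cV[int]_3 :=
  (\prod_(i <- s) gen i) *m v.

Lemma word_nil (v : 'cV[int]_3) : word [::] v = v.
Proof. by rewrite /word big_nil mul1mx. Qed.

Lemma word_cons (i : 'I_5) (s : seq 'I_5) (v : 'cV[int]_3) :
  word (i :: s) v = gen i *m word s v.
Proof. by rewrite /word big_cons -mulmxA. Qed.

Lemma word_marked (s : seq 'I_5) (v : 'cV[int]_3) : v \in start_vectors ->
  exists a b c : int,
    [/\ word s v = cv3 a b c, marked a b c & 0 < c < b].
Proof.
move=> /start_cv3[b0 [c0 [bal ax m ->]]]; elim: s => [|i s [a [b [c [E m' sec]]]]].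
  rewrite word_nil; do 3 eexists; split; [reflexivity | exact/marked_M3 |].
  case: m => _ Q _ _; rewrite sector_M3 //.
  by move: bal; rewrite balancedE; case: ax => /eqP; nia.
rewrite word_cons E gen_cv3; do 3 eexists; split; [reflexivity | | ].
  exact/marked_M3/marked_turn.
exact: sector_turn.
Qed.

(** On a ray between sectors, a^2 is the square of a coordinate, so a divides all
    three coordinates and primitivity gives a = 1. Of the six shortest vectors,
    the congruence modulo 4 keeps (0, 1), (1, 0) and (-1, -1), and the last one is
    on the border of the excluded sector. *)
Lemma marked_on_axis (a b c : int) : marked a b c ->
  [|| b == 0, c == 0 | b == c] -> (b < 0) && (c <= 0) ==> (c < b) ->
  (a, b, c) = (1, 0, 1) \/ (a, b, c) = (1, 1, 0).
Proof.
move=> [a0 Q [p [q [r E]]]]; rewrite balancedE => bal ax sec.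
have unit_a (k : int) : k * a = 1 -> a = 1.
  move=> ka; have : (a %| 1)%Z by apply/dvdzP; exists k.
  rewrite dvdz1; lia.
have sqr_a (y : int) : a ^+ 2 = y ^+ 2 -> y = a \/ y = - a.
  by move/eqP; rewrite eqf_sqr => /orP[] /eqP ->; rewrite ?opprK; [left | right].
case/or3P: ax => /eqP ax; subst.
- case: (sqr_a c) => [|Ec|Ec]; first by rewrite Q; ring.
    have a1 : a = 1 by apply: (unit_a (p + r)); rewrite -E Ec; ring.
    by left; rewrite Ec a1.
  have a1 : a = 1 by apply: (unit_a (p - r)); rewrite -E Ec; ring.
  by move: bal; rewrite Ec a1.
- case: (sqr_a b) => [|Eb|Eb]; first by rewrite Q; ring.
    have a1 : a = 1 by apply: (unit_a (p + q)); rewrite -E Eb; ring.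
    by right; rewrite Eb a1.
  by move: sec; rewrite Eb; lia.
case: (sqr_a c) => [|Ec|Ec]; first by rewrite Q; ring.
  have a1 : a = 1 by apply: (unit_a (p + q + r)); rewrite -E Ec; ring.
  by move: bal; rewrite Ec a1.
by move: sec; rewrite Ec; lia.
Qed.

(** The first coordinate of M3^-1 x is 7a - 6b, and the turns do not change it;
    it is smaller than a because a < b in the sector 0 < c < b. *)
Lemma descent (a b c : int) : marked a b c -> 0 < c < b ->
  (exists2 v, v \in start_vectors & v = cv3 a b c) \/
  (exists i a' b' c', [/\ marked a' b' c', 0 < c' < b', a' < a
     & gen i *m cv3 a' b' c' = cv3 a b c]).
Proof.
move=> m sec; have [a0 Q _ _] := m.
set a' := 7 * a - 6 * b; set b' := 7 * b - 8 * a; set c' := c - 4 * a + 3 * b.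
have Ea : 7 * a' + 6 * b' = a by rewrite /a' /b'; ring.
have Eb : 8 * a' + 7 * b' = b by rewrite /a' /b'; ring.
have Ec : 4 * a' + 3 * b' + c' = c by rewrite /a' /b' /c'; ring.
have m' : marked a' b' c' by apply/marked_M3; rewrite Ea Eb Ec.
have lt_ab : a < b by apply: ltr_of_sqr; nia.
have sec' : (b' < 0) && (c' <= 0) ==> (c' < b').
  by case: m' => a0' Q' _ _; rewrite -(sector_M3 a') // Ec Eb.
have [ax|] := boolP [|| b' == 0, c' == 0 | b' == c'].
  left; case: (marked_on_axis _ _ _ m' ax sec') => -[Ea' Eb' Ec'];
    move: Ea Eb Ec; rewrite Ea' Eb' Ec' => <- <- <-.
    by exists (cv3 7 8 5); [rewrite inE eqxx | congr cv3].
  by exists (cv3 13 15 7); [rewrite !inE eqxx orbT | congr cv3].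
rewrite !negb_or => /and3P[b0 c0 bc]; right.
have [i [b1 [c1 [sec1 E]]]] := turn_onto _ _ b0 c0 bc sec'.
exists i, a', b1, c1; rewrite gen_cv3 E Ea Eb Ec; split=> //; last first.
  by rewrite /a'; lia.
by apply/(marked_turn i); rewrite E.
Qed.

Lemma word_onto (a b c : int) : marked a b c -> 0 < c < b ->
  exists2 v, v \in start_vectors & exists s, word s v = cv3 a b c.
Proof.
have [n] := ubnP (absz a); elim: n a b c => // n IHn a b c lt_an m sec.
have [[v v_in Ev]|[i [a' [b' [c' [m' sec' lt_a E]]]]]] := descent _ _ _ m sec.
  by exists v => //; exists [::]; rewrite word_nil.
have a'0 : 0 < a' by case: m'.
have [|v v_in [s Es]] := IHn a' b' c' _ m' sec'; first lia.
by exists v => //; exists (i :: s); rewrite word_cons Es.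
Qed.

Lemma M3_inj {a b c a' b' c' : int} :
  cv3 (7 * a + 6 * b) (8 * a + 7 * b) (4 * a + 3 * b + c) =
  cv3 (7 * a' + 6 * b') (8 * a' + 7 * b') (4 * a' + 3 * b' + c') ->
  [/\ a = a', b = b' & c = c'].
Proof. by move=> /cv3_inj[? ? ?]; split; lia. Qed.

(** The inverse image by M3 is on a ray for a starting vector, and off the rays for
    the image by a generator. *)
Lemma start_neq_gen (v : 'cV[int]_3) (i : 'I_5) (a b c : int) :
  v \in start_vectors -> 0 < c < b -> v <> gen i *m cv3 a b c.
Proof.
move=> /start_cv3[b0 [c0 [_ ax _ ->]]] /(turn_off_axes i)/andP[b1 c1].
rewrite gen_cv3 => /M3_inj[_ Eb Ec].
by case: ax => /eqP E0; [move: b1; rewrite -Eb | move: c1; rewrite -Ec];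
  rewrite E0.
Qed.

Lemma word_inj (s s' : seq 'I_5) (v v' : 'cV[int]_3) :
  v \in start_vectors -> v' \in start_vectors -> word s v = word s' v' ->
  v = v' /\ s = s'.
Proof.
move=> vS v'S.
elim: s s' => [|i s IHs] [|j s']; rewrite ?word_nil ?word_cons //.
- have [a [b [c [-> _ sec]]]] := word_marked s' _ v'S => E.
  by case: (start_neq_gen v j a b c vS sec E).
- have [a [b [c [-> _ sec]]]] := word_marked s _ vS => E.
  by case: (start_neq_gen v' i a b c v'S sec (esym E)).
have [a [b [c [E m sec]]]] := word_marked s _ vS.
have [a' [b' [c' [E' m' sec']]]] := word_marked s' _ v'S.
rewrite E E' !gen_cv3 => /M3_inj[Ea Eb Ec].
have [] := turn_inj sec sec' (_ : turn i b c = turn j b' c').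
  by move: Eb Ec; case: (turn i b c) (turn j b' c') => ? ? [? ?] /= -> ->.
move=> Eij Ebb Ecc; have [|-> ->] := IHs s'; last by rewrite Eij.
by rewrite E E' Ea Ebb Ecc.
Qed.

(** Here x (x - y) = z^2 - y^2 is a difference of odd squares, hence divisible by
    8, while x - y is odd. *)
Lemma dvd4_of_even (x y z : int) : z ^+ 2 = x ^+ 2 - x * y + y ^+ 2 ->
  (x %% 2)%Z = 0 -> (y %% 2)%Z = 1 -> (x %% 4)%Z = 0.
Proof.
move=> E ex oy.
have [m Em] : exists m, x = 2 * m by exists (x %/ 2)%Z; lia.
have [n En] : exists n, y = 2 * n + 1 by exists (y %/ 2)%Z; lia.
have [k [Ek|Ek]] : exists k, z = 2 * k \/ z = 2 * k + 1.
- by exists (z %/ 2)%Z; lia.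
- by move: E; rewrite Em En Ek; lia.
by move: E; rewrite Em En Ek; lia.
Qed.

(** Primitivity makes exactly one of b, c and b - c even, and that one is divisible
    by 4. The form is b^2 - bc + c^2 = c^2 - cb + b^2 = (b - c)^2 - (b - c) b + b^2,
    so the three cases are instances of the same divisibility. *)
Lemma balanced_mirror (a b c : int) : a ^+ 2 = b ^+ 2 - b * c + c ^+ 2 ->
  (exists p q r : int, p * a + q * b + r * c = 1) ->
  balanced b (b - c) = ~~ balanced b c.
Proof.
move=> Q [p [q [r E]]].
have nb : ~ ((b %% 2)%Z = 0 /\ (c %% 2)%Z = 0).
  move=> [eb ec].
  have [m Em] : exists m, b = 2 * m by exists (b %/ 2)%Z; lia.
  have [n En] : exists n, c = 2 * n by exists (c %/ 2)%Z; lia.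
  have [k [Ek|Ek]] : exists k, a = 2 * k \/ a = 2 * k + 1.
  - by exists (a %/ 2)%Z; lia.
  - by move: E; rewrite Em En Ek; lia.
  by move: Q; rewrite Em En Ek; lia.
have hb := dvd4_of_even b c a Q.
have hc := dvd4_of_even c b a.
have hd := dvd4_of_even (b - c) b a.
rewrite !balancedE.
have {}hc : (c %% 2)%Z = 0 -> (b %% 2)%Z = 1 -> (c %% 4)%Z = 0.
  by apply: hc; rewrite Q; ring.
have {}hd : ((b - c) %% 2)%Z = 0 -> (b %% 2)%Z = 1 -> ((b - c) %% 4)%Z = 0.
  by apply: hd; rewrite Q; ring.
have [pb|pb] : (b %% 2)%Z = 0 \/ (b %% 2)%Z = 1 by lia.
  have pc : (c %% 2)%Z = 1 by lia.
  have b4 := hb pb pc; rewrite b4.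
  have [[-> ->]|[-> ->]] // : (c %% 4)%Z = 1 /\ ((b - c) %% 4)%Z = 3 \/
                              (c %% 4)%Z = 3 /\ ((b - c) %% 4)%Z = 1.
  by clear -b4 pc; lia.
have [pc|pc] : (c %% 2)%Z = 0 \/ (c %% 2)%Z = 1 by lia.
  have c4 := hc pc pb; rewrite c4.
  have [[-> ->]|[-> ->]] // : (b %% 4)%Z = 1 /\ ((b - c) %% 4)%Z = 1 \/
                              (b %% 4)%Z = 3 /\ ((b - c) %% 4)%Z = 3.
  by clear -c4 pb; lia.
have d4 : ((b - c) %% 4)%Z = 0 by apply: hd => //; lia.
rewrite d4.
have [[-> ->]|[-> ->]] // : (b %% 4)%Z = 1 /\ (c %% 4)%Z = 1 \/
                            (b %% 4)%Z = 3 /\ (c %% 4)%Z = 3.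
by clear -d4 pb; lia.
Qed.

(** * The classification *)

Lemma gcd3_bezout (a b c : int) : gcdz (gcdz a b) c = 1 <->
  exists p q r : int, p * a + q * b + r * c = 1.
Proof.
split=> [g1 | [p [q [r E]]]].
  have [u [v Euv]] := Bezoutz a b; have [w [r Ewr]] := Bezoutz (gcdz a b) c.
  by exists (w * u), (w * v), r; rewrite -g1 -Ewr -Euv; ring.
have : (gcdz (gcdz a b) c %| p * a + q * b + r * c)%Z.
  have gab := dvdz_gcdl (gcdz a b) c.
  by rewrite !rpredD // dvdz_mull ?dvdz_gcdr // (dvdz_trans gab)
     ?dvdz_gcdl ?dvdz_gcdr.
by rewrite E dvdz1 => /eqP E1; exact: (congr1 Posz E1).
Qed.

Lemma cv3_eta (w : 'cV[int]_3) : w = cv3 (w 0 0) (w 1 0) (w 2%:R 0).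
Proof.
apply/colP => k; rewrite mxE.
by case: k => [[|[|[|k]]] //= lt_k]; congr (w _ _); apply: val_inj.
Qed.

Lemma yieldsE (v : 'cV[int]_3) (s : seq 'I_5) (f : bool) (a b c : int) :
  yields (v, s, f) a b c <->
  v \in start_vectors /\ word s v = cv3 a b (if f then b - c else c).
Proof.
rewrite /yields -/(word s v); split=> -[vS E]; split=> //.
  by case: E => -> -> ->; case: f; rewrite ?subKr -cv3_eta.
by rewrite E !mxE /=; case: f {E}; rewrite ?subKr.
Qed.

Lemma yields_cone (d : code) (a b c : int) : yields d a b c ->
  [/\ 0 < a, a ^+ 2 = b ^+ 2 - b * c + c ^+ 2,
      exists p q r : int, p * a + q * b + r * c = 1 & 0 < c < b].
Proof.
case: d => [[v s] f] /yieldsE[vS].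
have [a' [b' [c' [-> [a0 Q [p [q [r E]]] _] sec]]]] := word_marked s v vS.
move=> /cv3_inj[<- <-]; case: f => Ec; last first.
  by rewrite -Ec; split=> //; exists p, q, r.
have -> : c = b' - c' by rewrite Ec; ring.
split; [by [] | by rewrite Q; ring | | by lia].
by exists p, (q + r), (- r); rewrite -E; ring.
Qed.

(** The flag is decided by which point of the mirror pair is balanced; the word
    and the starting vector then come from the descent. *)
Lemma yields_exists_unique (a b c : int) :
  0 < a -> a ^+ 2 = b ^+ 2 - b * c + c ^+ 2 ->
  (exists p q r : int, p * a + q * b + r * c = 1) -> 0 < c < b ->
  exists! d : code, yields d a b c.
Proof.
move=> a0 Q bz sec; have mir := balanced_mirror _ _ _ Q bz.
pose f := ~~ balanced b c.
have m : marked a b (if f then b - c else c).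
  rewrite /f; have [bal|nbal] := boolP (balanced b c); first by [].
  split=> //=; last by rewrite mir.
    by rewrite Q; ring.
  have [p [q [r E]]] := bz.
  by exists p, (q + r), (- r); rewrite -E; ring.
have [|v vS [s Es]] := word_onto _ _ _ m; first by case: (f); lia.
exists (v, s, f); split; first by apply/yieldsE.
case=> [[v' s'] f'] /yieldsE[v'S Es'].
have Ef : f = f'.
  have [a1 [b1 [c1 [E1 [_ _ _ bal] _]]]] := word_marked s' v' v'S.
  move: bal; have [_ -> ->] := cv3_inj (etrans (esym E1) Es').
  by rewrite /f; case: f' {Es'} => [|->] //; rewrite mir => ->.
have [|-> ->] := word_inj s s' v v' vS v'S; last by rewrite Ef.
by rewrite Es Es' Ef.
Qed.

Theorem mainTheorem1 (R : realType) :
  (forall a b c : int,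
     primitive_eisensteinian R a b c <->
     (a, b, c) = (1, 1, 1) \/ exists d : code, yields d a b c)
  /\
  (forall a b c : int,
     primitive_eisensteinian R a b c ->
     ((a, b, c) = (1, 1, 1) /\ ~ (exists d : code, yields d a b c)) \/
     ((a, b, c) <> (1, 1, 1) /\ exists! d : code, yields d a b c)).
Proof.
have uniq_code (a b c : int) : eisensteinian R a b c ->
    gcdz (gcdz a b) c = 1 -> c < b -> exists! d : code, yields d a b c.
  move=> /eisensteinianP[a0 b0 c0 Q] /gcd3_bezout bz lt_cb.
  by apply: yields_exists_unique; rewrite ?c0.
split=> a b c.
  split=> [[eis g1 [lt_cb|E]] | [[-> -> ->]|[d /yields_cone[a0 Q bz /andP[c0 lt_cb]]]]].
  - by right; have [d [yd _]] := uniq_code a b c eis g1 lt_cb; exists d.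
  - by left.
  - by split; [apply/eisensteinianP | | right].
  split; [| exact/gcd3_bezout | by left].
  by apply/eisensteinianP; split=> //; apply: lt_trans lt_cb.
move=> [eis g1 [lt_cb|E]].
  right; split; last exact: uniq_code.
  by move=> [_ Eb Ec]; move: lt_cb; rewrite Eb Ec.
left; split=> // -[d /yields_cone[_ _ _ /andP[_]]].
by case: E => _ -> ->.
Qed.
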